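(* Consider the game of competition in dual spheres (as specified in the context). Assume the joint signal distribution $F_{s_A,s_B}$ satisfies: for each $i\in\{A,B\}$ and every bounded measurable $g:S_{-i}\to\mathbb{R}$, if $\mathbb{E}[g(s_{-i})\mid s_i]=0$ for $F_{s_i}$-a.e. $s_i$, then $\Pr(g(s_{-i})=0\mid s_i)=1$ for $F_{s_i}$-a.e. $s_i$. Assume also that the government observes at least the market outcome, i.e., $m$ is measurable with respect to $\tau$. Then in any Bayes-Nash equilibrium $(\sigma_A^*,\sigma_B^*,\alpha^* )$ in which the firms play identifiable strategies: 1. If the firms do not value the government's action ($v(\cdot)=0$), then the market outcome $m(x_A,x_B)$ is almost surely constant on path. 2. Suppose $\mathcal{A}=[0,1]$, $v(a)=a$, and $u_G(a,\theta)=-(a-\theta)^2$ (with no direct dependence on $x_A,x_B$), where $\theta\in[0,1]$. Then $\operatorname{Cov}(m,\theta)=-\operatorname{Var}(m)\le 0$, where $m=m(x_A,x_B)$ and moments are under the equilibrium joint distribution of $(x_A,x_B,\theta)$.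
   Context: Competition in dual spheres. There are two firms $A,B$ ($-i$ denotes the firm other than $i$), a state $\theta\in\Theta\subset\mathbb{R}^n$, and private signals $s_i\in S_i\subset\mathbb{R}^n$ for each firm, drawn from a joint distribution $F_{s_A,s_B\mid\theta}$ conditional on $\theta$; $F_{s_A,s_B}$ is the unconditional joint signal distribution, with marginals $F_{s_A},F_{s_B}$ having supports $S_A,S_B$, and it is absolutely continuous with respect to $F_{s_A}\otimes F_{s_B}$. The firms simultaneously choose $x_i\in X_i$ ($X_i$ standard Borel). Firm $A$'s private market share (the market outcome) is $m(x_A,x_B)\in[0,1]$, where $m:X_A\times X_B\to[0,1]$. A government observes the statistic $t=\tau(x_A,x_B)\in\mathcal{T}$ and then chooses an action $a\in\mathcal{A}$; its payoff is $u_G(x_A,x_B,a,\theta)$. For a bounded function $v:\mathcal{A}\to\mathbb{R}$, firm $A$'s payoff is $m(x_A,x_B)+v(a)$ and firm $B$'s is $-m(x_A,x_B)-v(a)$. All spaces are standard Borel, all maps are measurable, and expectations are assumed well defined. A firm strategy is a measurable $\sigma_i:S_i\to\Delta(X_i)$; a government strategy is $\alpha:\mathcal{T}\to\Delta(\mathcal{A})$. A Bayes-Nash equilibrium is a profile in which each firm (for a.e. own signal) and the government maximize their expected payoffs given the others' strategies (so the government's action is optimal given the conditional distribution of $\theta$ given $\tau$, almost surely on path). Identifiable strategy: $\sigma_i$ is identifiable if for every bounded measurable $g:X_i\to\mathbb{R}$, [$\mathbb{E}[g(x_i)\mid s_i]=0$ for $F_{s_i}$-a.e. $s_i$] implies [$\Pr(g(x_i)=0\mid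 s_i)=1$ for $F_{s_i}$-a.e. $s_i$], where expectation and probability are taken under $x_i\sim\sigma_i(\cdot\mid s_i)$. *)

(* Defs.v *)
From HB Require Import structures.
From mathcomp Require Import all_boot all_order all_algebra.
From mathcomp Require Import all_classical all_reals all_analysis.
From mathcomp Require Import measurable_realfun.

Set Implicit Arguments.
Unset Strict Implicit.
Unset Printing Implicit Defensive.
Import Order.TTheory GRing.Theory Num.Theory.
Import numFieldNormedType.Exports.

Local Open Scope classical_set_scope.
Local Open Scope ring_scope.
Local Open Scope ereal_scope.

(* A [measurableType] is pointed, so only nonempty subsets of a measurable
   space are turned into measurable spaces. *)
Record nonempty_set (T : Type) := NonemptySet {
  carrier :> set T ;
  carrier_neq0 : carrier !=set0 }.

Definition points T (A : nonempty_set T) : Type := set_type A.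
HB.instance Definition _ (T : choiceType) (A : nonempty_set T) :=
  Choice.copy (points A) (set_type A).
HB.instance Definition _ (T : choiceType) (A : nonempty_set T) :=
  let p := cid (carrier_neq0 A) in
  isPointed.Build (points A) (exist _ (projT1 p) (mem_set (projT2 p))).

Definition point_val T (A : nonempty_set T) (x : points A) : T := set_val x.

(* [A] as a space of its own, with the trace sigma-algebra. *)
Definition subspace_of d (T : measurableType d) (A : nonempty_set T)
    : measurableType (preimage_display (@point_val T A)) :=
  g_sigma_algebra_preimageType (@point_val T A).

Definition subspace_val d (T : measurableType d) (A : nonempty_set T)
  (x : subspace_of A) : T := @point_val T A x.

Lemma itv01_neq0 (R : realType) : ([set` `[0%R, 1%R]] : set R) !=set0.
Proof. by exists (0%R : R); rewrite /= in_itv/= lexx ler01. Qed.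

Definition unit_interval (R : realType) : nonempty_set R :=
  NonemptySet (@itv01_neq0 R).

(* R^n is [n.-tuple R]; its neighbourhoods are the sup-norm balls. *)
Definition topological_support (R : realType) n
    (mu : set (n.-tuple R) -> \bar R) : set (n.-tuple R) :=
  [set x | forall e : R, (0 < e)%R ->
     0 < mu [set y | forall i, (`|tnth y i - tnth x i| < e)%R]].

Definition polish (R : realType) (P : metricType R) : Prop :=
  (exists2 D : set P, countable D & dense D) /\
  (forall F : set_system P, ProperFilter F -> cauchy F -> exists l : P, F --> l).

Definition standard_borel (R : realType) d (T : measurableType d) : Prop :=
  exists (P : metricType R) (f : T -> P),
    [/\ polish P, bijective f &
        @measurable d T = preimage_set_system setT f <<s @open P >>].

HB.instance Definition _ d1 d2 (T1 : measurableType d1)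
    (T2 : measurableType d2) :=
  isMeasurableFun.Build _ _ (T1 * T2)%type T1 fst (@measurable_fst _ _ T1 T2).
HB.instance Definition _ d1 d2 (T1 : measurableType d1)
    (T2 : measurableType d2) :=
  isMeasurableFun.Build _ _ (T1 * T2)%type T2 snd (@measurable_snd _ _ T1 T2).

Section comap.
Context d1 d2 d3 (X : measurableType d1) (Y : measurableType d2)
  (Z : measurableType d3) (R : realType).
Variables (K : R.-pker Y ~> Z) (f : {mfun X >-> Y}).

Definition kernel_comap (x : X) : {measure set Z -> \bar R} := K (f x).

Let measurable_kernel_comap U :
  measurable U -> measurable_fun [set: X] (kernel_comap ^~ U).
Proof.
move=> mU; exact: (measurableT_comp (measurable_kernel K U mU)).
Qed.

HB.instance Definition _ :=
  isKernel.Build _ _ X Z R kernel_comap measurable_kernel_comap.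

Let prob_kernel_comap x : kernel_comap x [set: Z] = 1.
Proof. exact: prob_kernel. Qed.

HB.instance Definition _ :=
  Kernel_isProbability.Build _ _ X Z R kernel_comap prob_kernel_comap.

End comap.

Section semidirect.
Context d1 d2 (X : measurableType d1) (Y : measurableType d2) (R : realType).
Variables (P : probability X R) (K : R.-pker X ~> Y).

(* The joint law of (x, y) when x ~ P and y ~ K x. *)
Definition semidirect (U : set (X * Y)) : \bar R :=
  \int[P]_x K x (xsection U x).

Let semidirect0 : semidirect set0 = 0.
Proof. by apply: integral0_eq => x _; rewrite xsection0 measure0. Qed.

Let semidirect_ge0 U : 0 <= semidirect U.
Proof. by apply: integral_ge0 => x _; exact: measure_ge0. Qed.

Let semidirect_sigma_additive : semi_sigma_additive semidirect.
Proof.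
move=> U mU tU mbigU; rewrite [X in _ --> X](_ : _ =
    \sum_(0 <= i <oo) semidirect (U i)).
  by apply: is_cvg_ereal_nneg_natsum => i _; exact: semidirect_ge0.
rewrite /semidirect -integral_nneseries//; last first.
  by move=> i; apply: measurable_fun_xsection_finite_kernel; rewrite inE.
apply: eq_integral => x _; rewrite xsection_bigcup.
apply/esym/cvg_lim => //; apply: measure_semi_sigma_additive.
- by move=> i; exact: measurable_xsection.
- exact: trivIset_xsection.
- rewrite -xsection_bigcup; exact: measurable_xsection.
Qed.

HB.instance Definition _ := isMeasure.Build _ _ _ semidirect
  semidirect0 semidirect_ge0 semidirect_sigma_additive.

Let semidirect_setT : semidirect [set: X * Y] = 1.
Proof.
rewrite /semidirect; under eq_integral do rewrite xsectionE/= prob_kernel.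
by rewrite integral_cst// mul1e; exact: probability_setT.
Qed.

HB.instance Definition _ :=
  Measure_isProbability.Build _ _ _ semidirect semidirect_setT.

End semidirect.

Section conditioning.
Context d1 d2 (X : measurableType d1) (Y : measurableType d2) (R : realType).

(* [K] is a regular conditional distribution of [g] given [f] under [P]. *)
Definition is_cond_law d (O : measurableType d) (P : probability O R)
    (f : O -> X) (g : O -> Y) (K : R.-pker X ~> Y) : Prop :=
  forall U V, measurable U -> measurable V ->
    P (f @^-1` U `&` g @^-1` V) = \int[P]_(w in f @^-1` U) K (f w) V.

(* Used both for strategies (K = sigma_i, P = law of s_i) and for the signal
   distribution (K = law of s_{-i} given s_i, P = law of s_i). *)
Definition identifiable (P : set X -> \bar R) (K : R.-pker X ~> Y) : Prop :=
  forall g : Y -> R, measurable_fun [set: Y] g ->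
    [bounded g y | y in [set: Y]] ->
    {ae P, forall x, \int[K x]_y (g y)%:E = 0} ->
    {ae P, forall x, K x [set y | g y = 0%R] = 1}.

(* [f] is quasi-integrable: its integral is not of the form oo - oo. *)
Definition has_expectation (P : {measure set X -> \bar R}) (f : X -> R) : Prop :=
  \int[P]_x (EFin \o f)^\+ x < +oo \/ \int[P]_x (EFin \o f)^\- x < +oo.

End conditioning.

Section firm.
Context dS dS' dX dX' dT dA (S : measurableType dS) (S' : measurableType dS')
  (X : measurableType dX) (X' : measurableType dX') (T : measurableType dT)
  (A : measurableType dA) (R : realType).
(* Primed data belong to the opponent; [K s] is the law of the opponent's
   signal given the own signal [s]. *)
Variables (u : X -> X' -> A -> R) (tau : X -> X' -> T)
  (K : R.-pker S ~> S') (sigma' : R.-pker S' ~> X') (alpha : R.-pker T ~> A).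

Definition interim_payoff (s : S) (nu : {measure set X -> \bar R}) : \bar R :=
  \int[K s]_s' \int[nu]_x \int[sigma' s']_x' \int[alpha (tau x x')]_a
    (u x x' a)%:E.

Definition firm_best_response (P : set S -> \bar R) (sigma : R.-pker S ~> X) :=
  {ae P, forall s, forall nu : probability X R,
     interim_payoff s nu <= interim_payoff s (sigma s)}.

End firm.

Section game.
Context dTh dSA dSB dXA dXB dT dA (R : realType)
  (Theta : measurableType dTh) (SA : measurableType dSA)
  (SB : measurableType dSB) (XA : measurableType dXA)
  (XB : measurableType dXB) (T : measurableType dT) (A : measurableType dA).

Variables (prior : probability Theta R) (F : R.-pker Theta ~> (SA * SB)%type).

Definition signal_law : probability (SA * SB)%type R :=
  distribution (semidirect prior F) snd.

Definition signal_lawA : probability SA R := distribution signal_law fst.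
Definition signal_lawB : probability SB R := distribution signal_law snd.

Variables (sigmaA : R.-pker SA ~> XA) (sigmaB : R.-pker SB ~> XB).

(* ((((state, (signal of A, signal of B)), action of A), action of B)). *)
Definition play : Type := Theta * (SA * SB) * XA * XB.

Definition state (w : play) : Theta := w.1.1.1.
Definition actions (w : play) : XA * XB := (w.1.2, w.2).

(* Given the signals, the firms randomize independently of each other and of
   the state. *)
Definition play_law : probability (Theta * (SA * SB) * XA * XB)%type R :=
  semidirect
    (semidirect (semidirect prior F) (kernel_comap sigmaA (fst \o snd)))
    (kernel_comap sigmaB (snd \o (snd \o fst))).

Variables (m : XA * XB -> R) (tau : XA * XB -> T) (v : A -> R)
  (uG : XA * XB -> A -> Theta -> R) (alpha : R.-pker T ~> A).

Definition payoffA (xA : XA) (xB : XB) (a : A) : R := m (xA, xB) + v a.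
Definition payoffB (xB : XB) (xA : XA) (a : A) : R := - m (xA, xB) - v a.

(* The government's action maximizes its expected payoff given the statistic t
   for almost every t on path; its payoffs are assumed to have expectations. *)
Definition government_best_response : Prop :=
  exists2 K : R.-pker T ~> ((XA * XB) * Theta)%type,
    is_cond_law play_law (tau \o actions) (fun w => (actions w, state w)) K &
    {ae pushforward play_law (tau \o actions), forall t,
      forall nu : probability A R,
        let u w := uG w.1.1 w.2 w.1.2 in
        has_expectation (K t \x nu) u /\
        \int[K t \x nu]_w (u w)%:E <= \int[K t \x alpha t]_w (u w)%:E}.

(* [KA] and [KB] are the regular conditional distributions of the opponent's
   signal given the own one; they are fixed versions, since conditional
   optimality is required only almost everywhere. *)
Definition bayes_nash (KA : R.-pker SA ~> SB) (KB : R.-pker SB ~> SA) : Prop :=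
  [/\ firm_best_response payoffA (fun xA xB => tau (xA, xB))
         KA sigmaB alpha signal_lawA sigmaA,
      firm_best_response payoffB (fun xB xA => tau (xA, xB))
         KB sigmaA alpha signal_lawB sigmaB &
      government_best_response].

End game.

(* Main.v *)
Require Import Defs.
From HB Require Import structures.
From mathcomp Require Import all_boot all_order all_algebra.
From mathcomp Require Import all_classical all_reals all_analysis.
From mathcomp Require Import measurable_realfun.
From mathcomp Require Import ring lra.

(* Against the strategy alpha of the government, the firms play a zero-sum game
   with payoff u = m + E_alpha(tau)[v]. Let mu_A be the unconditional law of
   x_A and V the equilibrium payoff. Since B could play any fixed action, mu_A
   earns at least V against every action of B; as A could play mu_A after every
   signal, A's interim payoff is V at a.e. signal, and so is, for mu_A-a.e. x,
   the interim payoff of x. Identifiability of A's beliefs about s_B turns the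
   latter into E[u(x, x_B) | s_B] = V a.s., and identifiability of sigma_B into
   u(x, x_B) = V a.s. Hence u = V almost surely under the product of the
   unconditional laws of the actions, and on path by absolute continuity.

   With quadratic losses the government plays E[theta | tau], so that
   m = V - E[theta | tau] and
   Cov(m, theta) = Cov(m, E[theta | tau]) = -Var(m). *)

Set Implicit Arguments.
Unset Strict Implicit.
Unset Printing Implicit Defensive.

Import Order.TTheory GRing.Theory Num.Theory.
Import numFieldNormedType.Exports.
Local Open Scope classical_set_scope.
Local Open Scope ring_scope.
Local Open Scope ereal_scope.

(** * Integration against kernels *)

Section measurable_section.
Context d1 d2 d3 (X : measurableType d1) (Y : measurableType d2)
  (Z : measurableType d3).
Variables (h : X * Y -> Z) (mh : measurable_fun [set: X * Y] h).

Lemma measurable_sectionr x : measurable_fun [set: Y] (fun y => h (x, y)).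
Proof. exact: (measurableT_comp mh (pair1_measurable x)). Qed.

Lemma measurable_sectionl y : measurable_fun [set: X] (fun x => h (x, y)).
Proof. exact: (measurableT_comp mh (pair2_measurable y)). Qed.

End measurable_section.

Section measurable_projections.
Context d1 d2 d3 (X : measurableType d1) (Y : measurableType d2)
  (Z : measurableType d3).

Lemma measurable_proj13 :
  measurable_fun [set: X * Y * Z] (fun t => (t.1.1, t.2)).
Proof.
by apply: measurable_fun_pair => //; exact: (measurableT_comp measurable_fst).
Qed.

Lemma measurable_proj23 :
  measurable_fun [set: X * Y * Z] (fun t => (t.1.2, t.2)).
Proof.
by apply: measurable_fun_pair => //; exact: (measurableT_comp measurable_snd).
Qed.

Lemma measurable_proj32 :
  measurable_fun [set: X * Y * Z] (fun t => (t.2, t.1.2)).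
Proof.
by apply: measurable_fun_pair => //; exact: (measurableT_comp measurable_snd).
Qed.

End measurable_projections.

Section kernel_law.
Context d1 d2 (X : measurableType d1) (Y : measurableType d2) (R : realType).
Variables (K : R.-pker X ~> Y) (x : X).

(** [K x] under a name that can carry the structure of a probability measure, which Tonelli and the
    bounds on integrals ask for; it is convertible to [K x], so the two are exchanged freely. *)
Definition kernel_law : set Y -> \bar R := K x.

HB.instance Definition _ := Measure.on kernel_law.

Let kernel_law_setT : kernel_law [set: Y] = 1.
Proof. exact: prob_kernel. Qed.

HB.instance Definition _ :=
  Measure_isProbability.Build _ _ _ kernel_law kernel_law_setT.

End kernel_law.

Section integral_kernel.
Context d1 d2 d3 (X : measurableType d1) (Y : measurableType d2)
  (Z : measurableType d3) (R : realType).

Lemma measurable_integral_pker (K : R.-pker X ~> Y) (h : X * Y -> \bar R) :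
  measurable_fun [set: X * Y] h -> (forall z, 0 <= h z) ->
  measurable_fun [set: X] (fun x => \int[K x]_y h (x, y)).
Proof. by move=> mh h0; exact: measurable_fun_integral_finite_kernel. Qed.

Lemma pker_fubini_tonelli (K : R.-pker X ~> Y) (x : X) (nu : probability Z R)
    (h : Z * Y -> \bar R) :
  measurable_fun [set: Z * Y] h -> (forall z, 0 <= h z) ->
  \int[K x]_y \int[nu]_z h (z, y) = \int[nu]_z \int[K x]_y h (z, y).
Proof.
move=> mh h0; transitivity (\int[kernel_law K x]_y \int[nu]_z h (z, y)).
  exact: eq_measure_integral.
by rewrite -fubini_tonelli.
Qed.

End integral_kernel.

Section pair_kernel.
Context d1 d2 (X : measurableType d1) (Y : measurableType d2) (R : realType).

Let pair_with (x : X) (y : Y) : X * Y := (x, y).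

Let measurable_pair_with x : measurable_fun [set: Y] (pair_with x).
Proof. exact: measurable_pair1. Qed.

HB.instance Definition _ x :=
  isMeasurableFun.Build _ _ _ _ (pair_with x) (measurable_pair_with x).

Variable K : R.-pker X ~> Y.

(** The kernel that keeps its input and adds a draw from [K]. The factor [unit] gives it the shape
    of the second factor in a composition of kernels. *)
Definition pair_kernel (u : unit * X) : {measure set (X * Y) -> \bar R} :=
  distribution (kernel_law K u.2) (pair_with u.2).

Let measurable_pair_kernel U :
  measurable U -> measurable_fun [set: unit * X] (pair_kernel ^~ U).
Proof.
move=> mU; rewrite (_ : pair_kernel ^~ U =
  (fun x => K x (xsection U x)) \o snd); last first.
  by apply/funext => u; rewrite /= xsectionE.
apply: measurableT_comp => //; apply: measurable_fun_xsection_finite_kernel.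
by rewrite inE.
Qed.

HB.instance Definition _ :=
  isKernel.Build _ _ _ _ R pair_kernel measurable_pair_kernel.

Let pair_kernel_setT u : pair_kernel u [set: X * Y] = 1.
Proof. exact: prob_kernel. Qed.

HB.instance Definition _ :=
  Kernel_isProbability.Build _ _ _ _ R pair_kernel pair_kernel_setT.

(** [semidirect P K] is the composition of [P], seen as a kernel from the one-point space, with
    [pair_kernel], so the formula is that for integrals against composed kernels. *)
Lemma ge0_integral_semidirect (P : probability X R) (h : X * Y -> \bar R) :
  measurable_fun [set: X * Y] h -> (forall z, 0 <= h z) ->
  \int[semidirect P K]_z h z = \int[P]_x \int[K x]_y h (x, y).
Proof.
move=> mh h0.
pose P' := kprobability
  (measurable_cst (P : pprobability X R) : measurable_fun [set: unit] _).
transitivity (\int[mkcomp P' pair_kernel tt]_z h z).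
  apply: eq_measure_integral => U mU _; rewrite /= /semidirect /kcomp /=.
  by apply: eq_integral => x _; rewrite xsectionE.
rewrite integral_kcomp//; apply: eq_integral => x _.
by rewrite ge0_integral_pushforward.
Qed.

End pair_kernel.

Section cond_law.
Context d d1 d2 (O : measurableType d) (X : measurableType d1)
  (Y : measurableType d2) (R : realType).
Variables (P : probability O R) (f : O -> X) (g : O -> Y) (K : R.-pker X ~> Y).
Hypotheses (mf : measurable_fun [set: O] f) (mg : measurable_fun [set: O] g).

Let fg w := (f w, g w).

Let measurable_fg : measurable_fun [set: O] fg.
Proof. exact: measurable_fun_pair. Qed.

HB.instance Definition _ := isMeasurableFun.Build _ _ _ _ f mf.
HB.instance Definition _ := isMeasurableFun.Build _ _ _ _ fg measurable_fg.

(** [is_cond_law] only speaks of rectangles. These are stable under intersection and generate the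
    product sigma-algebra, so the joint law of [f] and [g] is the semidirect product of the law of
    [f] with [K]. *)
Lemma ge0_integral_cond_law (h : X * Y -> \bar R) : is_cond_law P f g K ->
  measurable_fun [set: X * Y] h -> (forall z, 0 <= h z) ->
  \int[P]_w h (f w, g w) = \int[P]_w \int[K (f w)]_y h (f w, y).
Proof.
move=> condK mh h0.
transitivity (\int[distribution P fg]_z h z).
  by rewrite ge0_integral_pushforward.
transitivity (\int[semidirect (distribution P f) K]_z h z); last first.
  rewrite ge0_integral_semidirect// ge0_integral_pushforward//.
    exact: measurable_integral_pker.
  by move=> x _; exact: integral_ge0.
apply: eq_measure_integral => U mU _.
pose C : set (set (X * Y)) :=
  [set A `*` B | A in measurable & B in measurable].
(* The whole space is itself a rectangle of finite measure, so a constant sequence exhausts it. *)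
apply: (measure_unique C (fun=> setT)) => //.
- by rewrite measurable_prod_measurableType.
- move=> _ _ [A1 mA1 [B1 mB1 <-]] [A2 mA2 [B2 mB2 <-]].
  by exists (A1 `&` A2); [exact: measurableI|
    exists (B1 `&` B2); [exact: measurableI|rewrite setXI]].
- by move=> _; exists setT => //; exists setT => //; rewrite setXTT.
- by rewrite bigcup_const.
- move=> _ [A mA [B mB <-]] /=.
  rewrite /semidirect ge0_integral_pushforward//; last first.
    apply: measurable_fun_xsection_finite_kernel; rewrite inE.
    exact: measurableX.
  rewrite preimage_setT [LHS](condK A B)// [LHS]integral_mkcond.
  apply: eq_integral => w _; rewrite patchE /=.
  have [/set_mem/= Aw|Aw] := boolP (w \in _).
    by rewrite in_xsectionX// inE.
  by rewrite notin_xsectionX ?measure0//; apply: contra Aw; rewrite !inE.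
- move=> _; rewrite (le_lt_trans (probability_le1 _ _))//=.
  exact: ltry.
Qed.

End cond_law.

(** * Bounds on integrals and almost-everywhere statements *)

Section integral_bounds.
Context d (T : measurableType d) (R : realType) (P : probability T R).

Lemma ge_integral_cst (h : T -> \bar R) (c : R) : (0 <= c)%R ->
  measurable_fun [set: T] h -> (forall x, 0 <= h x) ->
  (forall x, h x <= c%:E) -> \int[P]_x h x <= c%:E.
Proof.
move=> c0 mh h0 hc.
rewrite -[leRHS]mule1 -[X in _ * X](@probability_setT _ _ _ P).
by rewrite -integral_cst//; apply: ge0_le_integral.
Qed.

Lemma le_integral_cst (h : T -> \bar R) (c : R) : (0 <= c)%R ->
  measurable_fun [set: T] h -> (forall x, 0 <= h x) ->
  {ae P, forall x, c%:E <= h x} -> c%:E <= \int[P]_x h x.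
Proof.
move=> c0 mh h0 hc.
rewrite -[leLHS]mule1 -[X in _ * X](@probability_setT _ _ _ P).
rewrite -integral_cst//; apply: ae_ge0_le_integral => //.
by apply: filterS hc.
Qed.

(** [g \- f] is nonnegative almost everywhere and its integral is at most zero. Finiteness of the
    integral of [f] makes the subtraction legitimate. *)
Lemma ae_eq_of_integral_le (f g : T -> \bar R) :
  measurable_fun [set: T] f -> measurable_fun [set: T] g ->
  (forall x, 0 <= f x) -> (forall x, 0 <= g x) ->
  {ae P, forall x, f x <= g x} ->
  \int[P]_x g x <= \int[P]_x f x -> \int[P]_x f x < +oo ->
  {ae P, forall x, f x = g x}.
Proof.
move=> mf mg f0 g0 fg gf foo.
have intf : P.-integrable setT f.
  apply/integrableP; split => //.
  by under eq_integral do rewrite gee0_abs//.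
have intg : P.-integrable setT g.
  apply/integrableP; split => //; under eq_integral do rewrite gee0_abs//.
  exact: le_lt_trans foo.
have mgf : measurable_fun setT (g \- f) by exact: emeasurable_funB.
have fgE : \int[P]_x `|(g \- f) x| = 0.
  rewrite (@ae_eq_integral _ _ _ P setT (g \- f))//; last 2 first.
  - exact: measurableT_comp.
  - have := integrable_ae measurableT intf.
    apply: filterS2 fg => x fgx + _ => /(_ I) ffin.
    by rewrite gee0_abs// sube_ge0// ffin.
  rewrite integralB//; apply/eqP; rewrite eq_le sube_le0// gf/=.
  rewrite sube_ge0 ?integrable_fin_num//.
  by apply: ae_ge0_le_integral => //; apply: filterS fg.
have := (ae_eq_integral_abs P measurableT mgf).1 fgE.
apply: filterS2 (integrable_ae measurableT intf) => x /(_ I) ffin /(_ I) /= gf0.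
by rewrite -(subeK (g x) ffin) gf0 add0e.
Qed.

Lemma ae_probability1 (A : set T) :
  measurable A -> P A = 1 -> {ae P, forall x, A x}.
Proof.
move=> mA PA; exists (~` A); split => //; first exact: measurableC.
by rewrite probability_setC// PA subee.
Qed.

End integral_bounds.

Section ae_prod.
Context d1 d2 (T1 : measurableType d1) (T2 : measurableType d2) (R : realType).
Variables (P1 : probability T1 R) (P2 : probability T2 R) (A : set (T1 * T2)).
Hypothesis mA : measurable A.

(** The two iterated integrals of the indicator of the complement of [A] agree by uniqueness of the
    product measure; a nonnegative function with zero integral vanishes almost everywhere. *)
Lemma ae_swap : {ae P1, forall x, {ae P2, forall y, A (x, y)}} ->
  {ae P2, forall y, {ae P1, forall x, A (x, y)}}.
Proof.
move=> aeA; have mC : measurable (~` A) by exact: measurableC.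
have PA : (P1 \x P2) (~` A) = 0.
  rewrite /product_measure1; have <- : \int[P1]_x (cst 0) x = 0.
    by rewrite integral_cst// mul0e.
  apply: ae_eq_integral => //; first exact: measurable_fun_xsection.
  apply: filterS aeA => x Ax _ /=.
  apply/negligibleP; first exact: measurable_xsection.
  by apply: negligibleS Ax => y; rewrite /xsection/= inE.
have PA' : (P1 \x^ P2) (~` A) = 0.
  rewrite -PA; apply/esym/product_measure_unique => // B C mB mC'.
  by rewrite /= product_measure2E.
have := (ae_eq_integral_abs P2 measurableT (measurable_fun_ysection P1 mC)).1.
under [X in X = 0 -> _]eq_integral do rewrite gee0_abs//.
move=> /(_ PA'); apply: filterS => y /(_ I) /= Ay.
exists (ysection (~` A) y); split => //; first exact: measurable_ysection.
by move=> x; rewrite /ysection/= inE.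
Qed.

End ae_prod.

(** * Zero-sum games with correlated signals *)

Section zero_sum.
Context dSA dSB dXA dXB (SA : measurableType dSA) (SB : measurableType dSB)
  (XA : measurableType dXA) (XB : measurableType dXB) (R : realType).
Variables (Q : probability (SA * SB)%type R) (KA : R.-pker SA ~> SB)
  (KB : R.-pker SB ~> SA) (sigmaA : R.-pker SA ~> XA)
  (sigmaB : R.-pker SB ~> XB) (u : XA * XB -> R) (c : R).

Local Notation PA := (distribution Q fst).
Local Notation PB := (distribution Q snd).

Hypotheses (mu : measurable_fun [set: XA * XB] u)
  (u0 : forall z, (0 <= u z)%R) (uc : forall z, (u z <= c)%R).
Hypotheses (condA : is_cond_law Q fst snd KA)
  (condB : is_cond_law Q snd fst KB).

Let c0 : (0 <= c)%R. Proof. exact: le_trans (u0 point) (uc point). Qed.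

Let mE : measurable_fun [set: XA * XB] (EFin \o u).
Proof. exact/measurable_EFinP. Qed.

Let uE0 z : 0 <= (EFin \o u) z. Proof. by rewrite /= lee_fin. Qed.

Definition payoff_againstB (z : XA * SB) : \bar R :=
  \int[sigmaB z.2]_x' (u (z.1, x'))%:E.

Definition payoff_againstA (z : SA * XB) : \bar R :=
  \int[sigmaA z.1]_x (u (x, z.2))%:E.

Definition signal_payoff (s : SA * SB) : \bar R :=
  \int[sigmaA s.1]_x payoff_againstB (x, s.2).

Definition interimA (z : SA * XA) : \bar R :=
  \int[KA z.1]_s' payoff_againstB (z.2, s').

(** The ex ante equilibrium payoff of A, the [V] of the overview. *)
Definition value : \bar R := \int[Q]_s signal_payoff s.

(** The [mu_A] of the overview. It also serves as a mixed action that A can play whatever its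
    signal. *)
Definition action_lawA : probability XA R :=
  distribution (semidirect PA sigmaA) snd.

Let pker_le d1 d2 (X : measurableType d1) (Y : measurableType d2)
    (K : R.-pker X ~> Y) x (h : Y -> \bar R) : measurable_fun [set: Y] h ->
  (forall y, 0 <= h y) -> (forall y, h y <= c%:E) -> \int[K x]_y h y <= c%:E.
Proof. exact: (ge_integral_cst (kernel_law K x)). Qed.

Let againstB0 z : 0 <= payoff_againstB z.
Proof. by apply: integral_ge0 => x _; rewrite lee_fin. Qed.

Let againstBc z : payoff_againstB z <= c%:E.
Proof.
apply: pker_le => [|y|y]; rewrite ?lee_fin//.
exact: (measurable_sectionr mE).
Qed.

(** [sigmaB] is pulled back along a projection to a kernel on the whole parameter space, so that the
    measurability of parametrized integrals applies. The measurability proofs below reuse this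
    device. *)
Let m_againstB : measurable_fun setT payoff_againstB.
Proof.
apply: (measurable_integral_pker (kernel_comap sigmaB snd)
  (h := fun z => (u (z.1.1, z.2))%:E)) => [|z]; last by rewrite lee_fin.
exact: (measurableT_comp mE (@measurable_proj13 _ _ _ XA SB XB)).
Qed.

Let againstA0 z : 0 <= payoff_againstA z.
Proof. by apply: integral_ge0 => x _; rewrite lee_fin. Qed.

Let m_againstA : measurable_fun setT payoff_againstA.
Proof.
apply: (measurable_integral_pker (kernel_comap sigmaA fst)
  (h := fun z => (u (z.2, z.1.2))%:E)) => [|z]; last by rewrite lee_fin.
exact: (measurableT_comp mE (@measurable_proj32 _ _ _ SA XB XA)).
Qed.

Let signal0 s : 0 <= signal_payoff s.
Proof. exact: integral_ge0. Qed.

Let signalc s : signal_payoff s <= c%:E.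
Proof.
apply: pker_le => //; exact: (measurable_sectionl m_againstB).
Qed.

Let m_signal : measurable_fun setT signal_payoff.
Proof.
apply: (measurable_integral_pker (kernel_comap sigmaA fst)
  (h := fun z => payoff_againstB (z.2, z.1.2))) => //.
exact: (measurableT_comp m_againstB (@measurable_proj32 _ _ _ SA SB XA)).
Qed.

(** Given both signals the actions are independent, so by Tonelli either action may be integrated
    first; this brings the payoff into the form in which the optimality of B is stated. *)
Let signalE s : signal_payoff s = \int[sigmaB s.2]_x' payoff_againstA (s.1, x').
Proof.
rewrite /signal_payoff; apply/esym.
exact: (pker_fubini_tonelli sigmaB s.2 (kernel_law sigmaA s.1)
  (h := EFin \o u)).
Qed.

Let interim0 z : 0 <= interimA z.
Proof. exact: integral_ge0. Qed.

Let m_interim : measurable_fun setT interimA.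
Proof.
apply: (measurable_integral_pker (kernel_comap KA fst)
  (h := fun z => payoff_againstB (z.1.2, z.2))) => //.
exact: (measurableT_comp m_againstB (@measurable_proj23 _ _ _ SA XA SB)).
Qed.

Let value0 : 0 <= value. Proof. exact: integral_ge0. Qed.

Let valuec : value <= c%:E. Proof. exact: ge_integral_cst. Qed.

Let value_fin : value \is a fin_num.
Proof. by rewrite ge0_fin_numE// (le_lt_trans valuec)// ltry. Qed.

Lemma integral_signal_fst (h : SA -> \bar R) : measurable_fun setT h ->
  (forall s, 0 <= h s) -> \int[PA]_s h s = \int[Q]_s h s.1.
Proof. by move=> mh h0; rewrite ge0_integral_pushforward. Qed.

Lemma integral_signal_snd (h : SB -> \bar R) : measurable_fun setT h ->
  (forall s, 0 <= h s) -> \int[PB]_s h s = \int[Q]_s h s.2.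
Proof. by move=> mh h0; rewrite ge0_integral_pushforward. Qed.

Lemma disintegrationA (h : SA * SB -> \bar R) : measurable_fun setT h ->
  (forall s, 0 <= h s) ->
  \int[Q]_s h (s.1, s.2) = \int[PA]_s \int[KA s]_s' h (s, s').
Proof.
move=> mh h0; rewrite integral_signal_fst.
- exact: (@ge0_integral_cond_law _ _ _ _ _ _ _ Q fst snd KA
    measurable_fst measurable_snd h condA).
- exact: measurable_integral_pker.
- by move=> s; exact: integral_ge0.
Qed.

Lemma disintegrationB (h : SB * SA -> \bar R) : measurable_fun setT h ->
  (forall s, 0 <= h s) ->
  \int[Q]_s h (s.2, s.1) = \int[PB]_s' \int[KB s']_s h (s', s).
Proof.
move=> mh h0; rewrite integral_signal_snd.
- exact: (@ge0_integral_cond_law _ _ _ _ _ _ _ Q snd fst KB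
    measurable_snd measurable_fst h condB).
- exact: measurable_integral_pker.
- by move=> s; exact: integral_ge0.
Qed.

Lemma integral_action_lawA (h : XA -> \bar R) : measurable_fun setT h ->
  (forall s, 0 <= h s) ->
  \int[action_lawA]_x h x = \int[PA]_s \int[sigmaA s]_x h x.
Proof.
move=> mh h0; rewrite ge0_integral_pushforward// preimage_setT.
rewrite (@ge0_integral_semidirect _ _ _ _ _ sigmaA PA (h \o snd))//.
  exact: measurableT_comp.
by move=> z; exact: h0.
Qed.

Hypothesis bestB : {ae PB, forall s', forall nu : probability XB R,
  \int[KB s']_s \int[sigmaB s']_x' payoff_againstA (s, x') <=
  \int[KB s']_s \int[nu]_x' payoff_againstA (s, x')}.

(** B, who minimizes [u], does not gain by switching to [x'] after a.e. signal; average this over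
    the signals of B. As [x'] ignores the signal, the correlation drops out and only the
    unconditional law of A's action remains. *)
Lemma value_le_action_lawA x' : value <= \int[action_lawA]_x (u (x, x'))%:E.
Proof.
have mux' : measurable_fun setT (fun x => (u (x, x'))%:E).
  exact: (measurable_sectionl mE).
have mAx' : measurable_fun setT (fun s => payoff_againstA (s, x')).
  exact: measurable_sectionl.
have -> : \int[action_lawA]_x (u (x, x'))%:E =
    \int[Q]_s payoff_againstA (s.1, x').
  rewrite integral_action_lawA//; last by move=> x; rewrite lee_fin.
  exact: (@integral_signal_fst (fun s => payoff_againstA (s, x'))).
have mswap : measurable_fun setT (fun z : SB * SA => (z.2, z.1)).
  exact: measurable_fun_pair.
have mpay := measurableT_comp m_signal mswap.
have mdev := measurableT_comp mAx' (@measurable_snd _ _ SB SA).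
have -> : value = \int[PB]_s' \int[KB s']_s signal_payoff (s, s').
  transitivity (\int[Q]_s signal_payoff (s.1, s.2)).
    by apply: eq_integral => -[].
  by apply: (disintegrationB mpay) => z; exact: signal0.
have -> : \int[Q]_s payoff_againstA (s.1, x') =
    \int[PB]_s' \int[KB s']_s payoff_againstA (s, x').
  by apply: (disintegrationB mdev) => z; exact: againstA0.
apply: ae_ge0_le_integral => //.
- by move=> s' _; exact: integral_ge0.
- by apply: (measurable_integral_pker KB mpay) => z; exact: signal0.
- by move=> s' _; exact: integral_ge0.
- by apply: (measurable_integral_pker KB mdev) => z; exact: againstA0.
(* The deviation is the Dirac mass at [x']. *)
apply: filterS bestB => s' /(_ (\d_x')) best _.
have -> : \int[KB s']_s signal_payoff (s, s') =
    \int[KB s']_s \int[sigmaB s']_x' payoff_againstA (s, x').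
  by apply: eq_integral => s _; exact: signalE.
apply: (le_trans best); rewrite le_eqVlt; apply/orP; left; apply/eqP.
apply: eq_integral => s _; rewrite integral_dirac//.
  by rewrite diracT mul1e.
exact: measurable_sectionr.
Qed.

Hypothesis bestA : {ae PA, forall s, forall nu : probability XA R,
  \int[KA s]_s' \int[nu]_x payoff_againstB (x, s') <=
  \int[KA s]_s' \int[sigmaA s]_x payoff_againstB (x, s')}.

(** Two squeezes: first the equilibrium interim payoff is at least [value] and averages to it; then
    each pure deviation earns at most [value], while their average under [action_lawA] is at least
    [value]. *)
Lemma interimA_value :
  {ae PA, forall s, {ae action_lawA, forall x, interimA (s, x) = value}}.
Proof.
pose w := fine value.
have wE : value = w%:E by rewrite fineK.
have w0 : (0 <= w)%R by exact: fine_ge0.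
pose V s := \int[KA s]_s' signal_payoff (s, s').
have mV : measurable_fun setT V by exact: measurable_integral_pker.
have V0 s : 0 <= V s by exact: integral_ge0.
have mBs' s' : measurable_fun setT (fun x => payoff_againstB (x, s')).
  exact: measurable_sectionl.
have mBx x : measurable_fun setT (fun s' => payoff_againstB (x, s')).
  exact: measurable_sectionr.
have VE : \int[PA]_s V s = value.
  transitivity (\int[Q]_s signal_payoff (s.1, s.2)).
    by rewrite disintegrationA.
  by apply: eq_integral => -[].
(* The previous lemma holds for every pure action of B, hence also against the mixed action
   [sigmaB s'], and then under any belief about [s']. *)
have guarantee s' : w%:E <= \int[action_lawA]_x payoff_againstB (x, s').
  rewrite -(@pker_fubini_tonelli _ _ _ _ _ _ _ sigmaB s' action_lawA
    (EFin \o u))//.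
  - apply: (le_integral_cst (P := kernel_law sigmaB s')) => //.
    + exact: (@measurable_fun_fubini_tonelli_G _ _ _ _ _ action_lawA
        (EFin \o u)).
    + by move=> x'; apply: integral_ge0 => x _; rewrite lee_fin.
    + by apply: aeW => x'; rewrite -wE; exact: value_le_action_lawA.
have guarantee' s :
    w%:E <= \int[KA s]_s' \int[action_lawA]_x payoff_againstB (x, s').
  apply: (le_integral_cst (P := kernel_law KA s)) => //.
  - exact: measurable_fun_fubini_tonelli_G.
  - by move=> s'; exact: integral_ge0.
  - exact: aeW.
(* [V s] is at least the payoff of the deviation to [action_lawA], thus at least [w]; its mean is
   [w], so equality holds almost surely. *)
have wV : {ae PA, forall s, w%:E = V s}.
  apply: ae_eq_of_integral_le => //.
  - by apply: filterS bestA => s /(_ action_lawA); exact/le_trans/guarantee'.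
  - by rewrite VE wE integral_cst// [X in _ * X]probability_setT mule1.
  - by rewrite integral_cst// [X in _ * X]probability_setT mule1 ltry.
apply: filterS2 wV bestA => s Vs bests.
(* A pure action is a Dirac deviation, so it cannot beat the interim payoff [V s]. *)
have interim_le x : interimA (s, x) <= w%:E.
  rewrite Vs; apply: le_trans (bests (\d_x)).
  rewrite le_eqVlt; apply/orP; left; apply/eqP; apply: eq_integral => s' _.
  by rewrite integral_dirac// diracT mul1e.
rewrite wE; apply: ae_eq_of_integral_le => //.
- exact: measurable_sectionr.
- exact: aeW.
- rewrite integral_cst// [X in _ * X]probability_setT mule1.
  by rewrite -(@pker_fubini_tonelli _ _ _ _ _ _ _ KA s action_lawA).
- apply: le_lt_trans (ltry w); apply: ge_integral_cst => //.
  exact: measurable_sectionr.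
Qed.

Hypotheses (idA : identifiable PA KA) (idB : identifiable PB sigmaB).

(** Identifiability is applied twice with [x] fixed: beliefs of A recover the conditional payoff at
    each signal of B, then [sigmaB] recovers the payoff at each action of B. *)
Lemma payoff_value_ae : {ae action_lawA, forall x, {ae PB, forall s',
  sigmaB s' [set x' | u (x, x') = fine value] = 1}}.
Proof.
pose w := fine value.
have wE : value = w%:E by rewrite fineK.
have w0 : (0 <= w)%R by exact: fine_ge0.
have mA : measurable [set z | interimA z = value].
  by have := m_interim measurableT (emeasurable_set1 value); rewrite setTI.
(* Identifiability tests one function against almost every own signal. Hence the quantifiers are
   swapped, so that the function may depend on [x] but not on [s]. *)
apply: filterS (ae_swap mA interimA_value) => x /= Hx.
have mBx : measurable_fun setT (fun s' => payoff_againstB (x, s')).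
  exact: measurable_sectionr.
have mux : measurable_fun setT (fun x' => u (x, x')).
  exact: measurable_sectionr.
have Bfin z : payoff_againstB z \is a fin_num.
  by rewrite ge0_fin_numE// (le_lt_trans (againstBc z))// ltry.
(* Identifiability is about functions with conditional mean zero, so payoffs are centred at [w];
   boundedness allows the integral of the difference to be split. *)
have intE d1 d2 (X : measurableType d1) (Y : measurableType d2)
    (K : R.-pker X ~> Y) z (h : Y -> R) : measurable_fun setT h ->
    (forall y, (0 <= h y)%R) -> (forall y, (h y <= c)%R) ->
    \int[K z]_y (h y)%:E = w%:E -> \int[K z]_y (h y - w)%:E = 0.
  move=> mh h0 hc hw.
  rewrite -[LHS]/(\int[kernel_law K z]_y ((h y)%:E - w%:E)).
  rewrite integralB_EFin//; last 2 first.
  - apply: measurable_bounded_integrable => //.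
      by rewrite [ltLHS]probability_setT ltry.
    exists c; split; [exact: num_real|move=> M cM y _ /=].
    by rewrite ger0_norm// (le_trans (hc y))// ltW.
  - exact: finite_measure_integrable_cst.
  rewrite -[X in X - _]/(\int[K z]_y (h y)%:E) hw integral_cst//.
  by rewrite [X in _ * X]probability_setT mule1 subee.
have bnd d2 (Y : measurableType d2) (h : Y -> R) : (forall y, (0 <= h y)%R) ->
    (forall y, (h y <= c)%R) -> [bounded (h y - w)%R | y in [set: Y]].
  move=> h0 hc; exists (c + w)%R; split; first exact: num_real.
  move=> M cM y _ /=; rewrite (le_trans _ (ltW cM))//.
  by rewrite (le_trans (ler_normB _ _))// !ger0_norm// lerD2r.
pose g s' := (fine (payoff_againstB (x, s')) - w)%R.
have mg : measurable_fun setT g.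
  by apply: measurable_funB => //; apply: measurableT_comp.
have g1 : {ae PA, forall s, KA s [set s' | g s' = 0%R] = 1}.
  apply: idA => //.
    by apply: bnd => s'; rewrite ?fine_ge0// -lee_fin fineK.
  apply: filterS Hx => s Hs; apply: intE.
  - exact: measurableT_comp.
  - by move=> s'; rewrite fine_ge0.
  - by move=> s'; rewrite -lee_fin fineK.
  - by rewrite -wE -Hs; apply: eq_integral => s' _; rewrite fineK.
have mgA : measurable [set s' | g s' = 0%R].
  by have := mg measurableT _ (measurable_set1 0%R); rewrite setTI.
(* Averaging the conditional probabilities, which are one, over the signals of A gives probability
   one under the law of B's signal. *)
have g0 : {ae PB, forall s', g s' = 0%R}.
  apply: ae_probability1 => //.
  rewrite -[LHS]/(Q (snd @^-1` [set s' | g s' = 0%R])).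
  rewrite -[X in Q X]setTI -(preimage_setT fst) condA// preimage_setT.
  rewrite -(@integral_signal_fst (fun s => KA s [set s' | g s' = 0%R]))//.
    rewrite (@ae_eq_integral _ _ _ PA setT (cst 1))//.
    - by rewrite integral_cst// [X in _ * X]probability_setT mule1.
    - exact: measurable_kernel.
    - by apply: filterS g1.
  exact: measurable_kernel.
have := @idB (fun x' => u (x, x') - w)%R; rewrite /= => idBx.
have : {ae PB, forall s', sigmaB s' [set x' | (u (x, x') - w)%R = 0%R] = 1}.
  apply: idBx; first exact: measurable_funB.
    exact: bnd.
  apply: filterS g0 => s' /subr0_eq gs'; apply: intE => //.
  by rewrite -gs' fineK.
apply: filterS => s' <-; congr (sigmaB s' _); apply/seteqP; split => x' /=.
  by move=> ->; rewrite subrr.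
by move/subr0_eq.
Qed.

Hypothesis abs_cont : Q `<< (PA \x PB).

(** The integral is the probability that the payoff differs from [value]. It vanishes when the
    signals are drawn independently from their marginals, and absolute continuity transfers this to
    [Q]. *)
Theorem on_path_payoff_value : \int[Q]_s \int[sigmaA s.1]_x
  sigmaB s.2 (xsection [set z | u z != fine value] x) = 0.
Proof.
pose N := [set z | u z != fine value].
have mN : measurable N.
  rewrite (_ : N = ~` (u @^-1` [set fine value])); last first.
    by apply/seteqP; split => z /eqP.
  by have := mu measurableT (measurable_set1 (fine value));
    rewrite setTI; exact: measurableC.
pose Z (z : XA * SB) := sigmaB z.2 (xsection N z.1).
have mZ : measurable_fun setT Z.
  rewrite (_ : Z = fun z => kernel_comap sigmaB snd z
      (xsection [set t : (XA * SB) * XB | N (t.1.1, t.2)] z)); last first.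
    by apply/funext => z; congr (sigmaB _ _); apply/seteqP; split => x' /=;
      rewrite /xsection/= !inE.
  apply: measurable_fun_xsection_finite_kernel; rewrite inE.
  have := @measurable_proj13 _ _ _ XA SB XB measurableT _ mN.
  by rewrite setTI.
have Z0 z : 0 <= Z z by [].
pose r (s : SA * SB) := \int[sigmaA s.1]_x Z (x, s.2).
have mr : measurable_fun setT r.
  apply: (measurable_integral_pker (kernel_comap sigmaA fst)
    (h := fun z => Z (z.2, z.1.2))) => //.
  exact: (measurableT_comp mZ (@measurable_proj32 _ _ _ SA SB XA)).
have r0 s : 0 <= r s by exact: integral_ge0.
have mZPB : measurable_fun setT (fun x => \int[PB]_s' Z (x, s')).
  exact: measurable_fun_fubini_tonelli_F.
have mZswap : measurable_fun setT (fun z : SB * XA => Z (z.2, z.1)).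
  exact: (measurableT_comp mZ
    (measurable_fun_pair measurable_snd measurable_fst)).
(* Under the product law, A's action and B's signal are independent, so integrating out A's signal
   leaves [action_lawA] and [payoff_value_ae] applies. *)
have rPAB : \int[PA \x PB]_s r s = 0.
  rewrite fubini_tonelli1//=.
  transitivity (\int[PA]_s \int[sigmaA s]_x \int[PB]_s' Z (x, s')).
    apply: eq_integral => s _.
    exact: (fubini_tonelli (m1 := PB) (m2 := kernel_law sigmaA s)
      (fun z => Z (z.2, z.1)) mZswap).
  rewrite -integral_action_lawA//; last by move=> x; exact: integral_ge0.
  rewrite (@ae_eq_integral _ _ _ action_lawA setT (cst 0))//.
    by rewrite integral_cst// mul0e.
  apply: filterS payoff_value_ae => x Hx _ /=.
  rewrite (@ae_eq_integral _ _ _ PB setT (cst 0))//.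
  - by rewrite integral_cst// mul0e.
  - exact: measurable_sectionr.
  apply: filterS Hx => s' Hs' _; rewrite /Z/=.
  have -> : xsection N x = ~` [set x' | u (x, x') = fine value].
    by apply/seteqP; split => x'; rewrite /xsection/= inE /N/= => /eqP.
  rewrite -[LHS]/(kernel_law sigmaB s' _) probability_setC; last first.
    have mux : measurable_fun setT (fun x' => u (x, x')).
      exact: measurable_sectionr.
    by have := mux measurableT _ (measurable_set1 (fine value)); rewrite setTI.
  by rewrite -[X in _ - X]/(sigmaB s' _) Hs' subee.
have : ae_eq (PA \x PB) setT r (cst 0).
  apply/(ae_eq_integral_abs _ measurableT mr).
  by under eq_integral do rewrite gee0_abs//.
move=> [M [mM M0 rM]].
have QM : Q M = 0.
  (* Domination is phrased with sets all of whose measurable subsets have measure zero, hence the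
     detour through the subsets [A] of [M]. *)
  by apply: (abs_cont _ mM (@subset_refl _ M)) => A mA AM;
    exact: (subset_measure0 mA mM AM M0).
rewrite -[LHS]/(\int[Q]_s r s) (@ae_eq_integral _ _ _ Q setT (cst 0))//.
  by rewrite integral_cst// mul0e.
by exists M.
Qed.

End zero_sum.

(** * The game between the firms *)

Section game_payoff.
Context dTh dSA dSB dXA dXB dT dA (R : realType)
  (Theta : measurableType dTh) (SA : measurableType dSA)
  (SB : measurableType dSB) (XA : measurableType dXA)
  (XB : measurableType dXB) (T : measurableType dT) (A : measurableType dA).
Variables (prior : probability Theta R) (F : R.-pker Theta ~> (SA * SB)%type).
Variables (sigmaA : R.-pker SA ~> XA) (sigmaB : R.-pker SB ~> XB).

Lemma measurable_actions :
  measurable_fun [set: Theta * (SA * SB) * XA * XB]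
    (@actions _ _ _ _ _ _ _ _ _ _).
Proof. exact: (@measurable_proj23 _ _ _ (Theta * (SA * SB))%type XA XB). Qed.

Lemma measurable_state :
  measurable_fun [set: Theta * (SA * SB) * XA * XB]
    (@state _ _ _ _ _ _ _ _ _ _).
Proof.
by do 2 apply: measurableT_comp => //.
Qed.

(** The strategies depend on the signals only, so the state integrates out and [signal_law] is
    left. *)
Lemma play_law_actions (N : set (XA * XB)) : measurable N ->
  play_law prior F sigmaA sigmaB (@actions _ _ _ _ _ _ _ _ _ _ @^-1` N) =
  \int[signal_law prior F]_s \int[sigmaA s.1]_x sigmaB s.2 (xsection N x).
Proof.
move=> mN.
pose U := @actions _ _ _ _ _ Theta SA SB XA XB @^-1` N.
have mU : measurable U.
  by have := measurable_actions measurableT mN; rewrite setTI.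
pose K := kernel_comap sigmaB (snd \o (snd \o fst)) :
  R.-pker (Theta * (SA * SB) * XA) ~> XB.
pose L := kernel_comap sigmaA (fst \o snd) : R.-pker (Theta * (SA * SB)) ~> XA.
have mKU : measurable_fun setT (fun z => K z (xsection U z)).
  by apply: measurable_fun_xsection_finite_kernel; rewrite inE.
transitivity (\int[semidirect (semidirect prior F) L]_z K z (xsection U z)).
  by [].
rewrite (ge0_integral_semidirect L (semidirect prior F))//.
pose W (s : SA * SB) := \int[sigmaA s.1]_x sigmaB s.2 (xsection N x).
have mW : measurable_fun setT W.
  apply: (measurable_integral_pker (kernel_comap sigmaA fst)
    (h := fun z => sigmaB z.1.2 (xsection N z.2))) => //.
  pose N' := [set t : (SA * SB * XA) * XB | N (t.1.2, t.2)].
  have mN' : measurable N'.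
    have := @measurable_proj23 _ _ _ (SA * SB)%type XA XB measurableT _ mN.
    by rewrite setTI.
  rewrite (_ : (fun _ => _) = fun z =>
      kernel_comap sigmaB (snd \o fst) z (xsection N' z)); last first.
    by apply/funext => z; congr (sigmaB _ _); apply/seteqP; split => x' /=;
      rewrite /xsection/= !inE.
  by apply: measurable_fun_xsection_finite_kernel; rewrite inE.
have W0 s : 0 <= W s by exact: integral_ge0.
by rewrite -[RHS]/(\int[signal_law prior F]_s W s) ge0_integral_pushforward.
Qed.

Variables (m : XA * XB -> R) (tau : XA * XB -> T) (v : A -> R)
  (uG : XA * XB -> A -> Theta -> R) (alpha : R.-pker T ~> A)
  (KA : R.-pker SA ~> SB) (KB : R.-pker SB ~> SA).
Hypotheses (mm : measurable_fun [set: XA * XB] m)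
  (m01 : forall x, (0 <= m x <= 1)%R)
  (mtau : measurable_fun [set: XA * XB] tau)
  (mv : measurable_fun [set: A] v) (v01 : forall a, (0 <= v a <= 1)%R).

(** Taken in [R] because the zero-sum payoff is real-valued; the integral is finite since [v] lies
    between 0 and 1. With the state in place of [v] and its conditional law in place of [alpha], the
    same definition yields conditional means below. *)
Definition expected_value (t : T) : R := fine (\int[alpha t]_a (v a)%:E).

Let v0 a : 0 <= (v a)%:E. Proof. by rewrite lee_fin; case/andP: (v01 a). Qed.

Let integral_v t : 0 <= \int[alpha t]_a (v a)%:E <= 1%:E.
Proof.
apply/andP; split; first exact: integral_ge0.
apply: (ge_integral_cst (kernel_law alpha t)) => //.
  exact/measurable_EFinP.
by move=> a; rewrite lee_fin; case/andP: (v01 a).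
Qed.

Lemma expected_valueE t : (expected_value t)%:E = \int[alpha t]_a (v a)%:E.
Proof.
have /andP[e0 e1] := integral_v t.
by rewrite fineK// ge0_fin_numE// (le_lt_trans e1)// ltry.
Qed.

Lemma expected_value01 t : (0 <= expected_value t <= 1)%R.
Proof. by rewrite -!lee_fin expected_valueE. Qed.

Lemma measurable_expected_value : measurable_fun [set: T] expected_value.
Proof.
apply: measurableT_comp => //.
apply: measurable_fun_integral_kernel => //; last exact/measurable_EFinP.
by move=> U; exact: measurable_kernel.
Qed.

Definition total_payoff (x : XA * XB) : R := (m x + expected_value (tau x))%R.

Let total0 x : (0 <= total_payoff x)%R.
Proof.
by rewrite addr_ge0//; [case/andP: (m01 x)|
  case/andP: (expected_value01 (tau x))].
Qed.

(** Both summands are at most one; [2] becomes the bound [c] of the zero-sum game. *)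
Let total2 x : (total_payoff x <= 2)%R.
Proof.
by rewrite -[2%R]/(1 + 1)%R lerD//; [case/andP: (m01 x)|
  case/andP: (expected_value01 (tau x))].
Qed.

Let mtotal : measurable_fun [set: XA * XB] total_payoff.
Proof.
apply: measurable_funD => //.
exact: (measurableT_comp measurable_expected_value).
Qed.

Let m0 x : 0 <= (m x)%:E. Proof. by rewrite lee_fin; case/andP: (m01 x). Qed.

Let integral_payoffA xA xB :
  \int[alpha (tau (xA, xB))]_a (payoffA m v xA xB a)%:E =
  (total_payoff (xA, xB))%:E.
Proof.
under eq_integral do rewrite EFinD.
rewrite ge0_integralD//; last exact/measurable_EFinP.
rewrite integral_cst//.
rewrite [X in _ * X](@probability_setT _ _ _ (kernel_law alpha _)).
by rewrite mule1 -expected_valueE.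
Qed.

Let integral_payoffB xA xB :
  \int[alpha (tau (xA, xB))]_a (payoffB m v xB xA a)%:E =
  - (total_payoff (xA, xB))%:E.
Proof.
rewrite -integral_payoffA -integral_ge0N => [|a _].
  by apply: eq_integral => a _; rewrite -EFinN opprD.
by rewrite EFinD adde_ge0.
Qed.

Lemma interim_payoffA s nu :
  interim_payoff (payoffA m v) (fun xA xB => tau (xA, xB)) KA sigmaB alpha
    s nu =
  \int[KA s]_s' \int[nu]_x payoff_againstB sigmaB total_payoff (x, s').
Proof.
apply: eq_integral => s' _; apply: eq_integral => x _.
by apply: eq_integral => x' _; exact: integral_payoffA.
Qed.

(** Nonnegativity of [total_payoff] lets the sign pass through every integral. A best response of B
    thus minimizes the payoff of A. *)
Lemma interim_payoffB s' nu :
  interim_payoff (payoffB m v) (fun xB xA => tau (xA, xB)) KB sigmaA alpha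
    s' nu =
  - \int[KB s']_s \int[nu]_x' payoff_againstA sigmaA total_payoff (s, x').
Proof.
have againstA0 z : 0 <= payoff_againstA sigmaA total_payoff z.
  by apply: integral_ge0 => x _; rewrite lee_fin.
rewrite -integral_ge0N => [|s _]; last exact: integral_ge0.
apply: eq_integral => s _; rewrite -integral_ge0N//.
apply: eq_integral => x' _.
rewrite -integral_ge0N => [|x _]; last by rewrite lee_fin.
by apply: eq_integral => x _; exact: integral_payoffB.
Qed.

Hypotheses (abs_cont : signal_law prior F `<<
     (signal_lawA prior F \x signal_lawB prior F))
  (cond_KA : is_cond_law (signal_law prior F) fst snd KA)
  (cond_KB : is_cond_law (signal_law prior F) snd fst KB)
  (signals_A : identifiable (signal_lawA prior F) KA)
  (id_sigmaB : identifiable (signal_lawB prior F) sigmaB)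
  (bn : bayes_nash prior F sigmaA sigmaB m tau v uG alpha KA KB).

(** With the government's strategy fixed, the two best-response conditions are those of the zero-sum
    game with payoff [total_payoff]; the constant is its equilibrium payoff. *)
Theorem total_payoff_constant : exists c : R,
  {ae play_law prior F sigmaA sigmaB, forall w,
    (m (actions w) + expected_value (tau (actions w)))%R = c}.
Proof.
have [bestA bestB _] := bn.
pose c := fine (value (signal_law prior F) sigmaA sigmaB total_payoff).
exists c; pose N := [set z | total_payoff z != c].
have mN : measurable N.
  rewrite (_ : N = ~` (total_payoff @^-1` [set c])); last first.
    by apply/seteqP; split => z /eqP.
  by have := mtotal measurableT (measurable_set1 c);
    rewrite setTI; exact: measurableC.
exists (@actions _ _ _ _ _ _ _ _ _ _ @^-1` N); split.
- by have := measurable_actions measurableT mN; rewrite setTI.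
- rewrite play_law_actions//.
  pose Q := signal_law prior F.
  pose againstA := payoff_againstA sigmaA total_payoff.
  pose againstB := payoff_againstB sigmaB total_payoff.
  have bB : {ae distribution Q snd, forall s', forall nu : probability XB R,
      \int[KB s']_s \int[sigmaB s']_x' againstA (s, x') <=
      \int[KB s']_s \int[nu]_x' againstA (s, x')}.
    apply: filterS bestB => s' best nu.
    by have := best nu; rewrite !interim_payoffB leeN2.
  have bA : {ae distribution Q fst, forall s, forall nu : probability XA R,
      \int[KA s]_s' \int[nu]_x againstB (x, s') <=
      \int[KA s]_s' \int[sigmaA s]_x againstB (x, s')}.
    apply: filterS bestA => s best nu.
    by have := best nu; rewrite !interim_payoffA.
  exact: (@on_path_payoff_value _ _ _ _ _ _ _ _ _ Q KA KB sigmaA sigmaB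
    total_payoff 2%R mtotal total0 total2 cond_KA cond_KB
    bB bA signals_A id_sigmaB abs_cont).
- by move=> w /eqP.
Qed.

End game_payoff.

(** * Quadratic losses *)

Section bounded_integrals.
Context d (T : measurableType d) (R : realType) (P : probability T R).

Lemma bounded_integrable (f : T -> R) (M : R) : measurable_fun [set: T] f ->
  (forall x, (`|f x| <= M)%R) -> P.-integrable [set: T] (EFin \o f).
Proof.
move=> mf fM; apply: measurable_bounded_integrable => //.
  by rewrite [ltLHS]probability_setT ltry.
exists M; split; first exact: num_real.
by move=> N MN x _ /=; rewrite (le_trans (fM x))// ltW.
Qed.

Lemma integral_EFin_Rintegral (f : T -> R) :
  P.-integrable [set: T] (EFin \o f) ->
  \int[P]_x (f x)%:E = (\int[P]_x f x)%R%:E.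
Proof. by move=> intf; rewrite fineK// integrable_fin_num. Qed.

End bounded_integrals.

Section quadratic_loss.
Context d d' (Z : measurableType d) (A : measurableType d') (R : realType).
Variables (P : probability Z R) (theta : Z -> R) (v : A -> R).
Hypotheses (mtheta : measurable_fun [set: Z] theta)
  (theta01 : forall z, (0 <= theta z <= 1)%R)
  (mv : measurable_fun [set: A] v)
  (v_surj : forall r, (0 <= r <= 1)%R -> exists a, v a = r).

Let b := (\int[P]_z theta z)%R.

Let int_theta : P.-integrable [set: Z] (EFin \o theta).
Proof.
apply: (@bounded_integrable _ _ _ P theta 1%R) => // z.
by have /andP[z0 z1] := theta01 z; rewrite ger0_norm.
Qed.

Let b01 : (0 <= b <= 1)%R.
Proof.
rewrite -!lee_fin -integral_EFin_Rintegral//; apply/andP; split.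
  by apply: integral_ge0 => z _; rewrite lee_fin; case/andP: (theta01 z).
apply: ge_integral_cst => //; first exact/measurable_EFinP.
  by move=> z; rewrite lee_fin; case/andP: (theta01 z).
by move=> z; rewrite lee_fin; case/andP: (theta01 z).
Qed.

Let mdev a : measurable_fun [set: Z] (fun z => a - theta z)%R.
Proof. exact: measurable_funB. Qed.

Let sqdev_le1 z : (`|(b - theta z) ^+ 2| <= 1)%R.
Proof.
have /andP[z0 z1] := theta01 z; have /andP[b0 b1] := b01.
by rewrite normrX expr_le1// ler_norml; apply/andP; split; lra.
Qed.

(** Write [a - theta z] as [(a - b) + (b - theta z)]. The cross term integrates to zero because [b]
    is the mean of [theta]. *)
Lemma bias_variance a : \int[P]_z ((a - theta z) ^+ 2)%:E =
  ((a - b) ^+ 2)%:E + \int[P]_z ((b - theta z) ^+ 2)%:E.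
Proof.
have int_sq : P.-integrable setT (EFin \o (fun z => (b - theta z) ^+ 2)%R).
  apply: (@bounded_integrable _ _ _ P _ 1%R) => //.
  exact: measurable_funX.
have int_cst r : P.-integrable setT (EFin \o (cst r : Z -> R)).
  exact: finite_measure_integrable_cst.
have int_dev : P.-integrable setT (EFin \o (fun z => b - theta z)%R).
  exact: (integrableB measurableT (int_cst b) int_theta).
have int_lin : P.-integrable setT
    (EFin \o (fun z => 2 * (a - b) * (b - theta z))%R).
  exact: (integrableZl measurableT (2 * (a - b))%R int_dev).
have int_aff : P.-integrable setT
    (EFin \o (fun z => (a - b) ^+ 2 + 2 * (a - b) * (b - theta z))%R).
  exact: (integrableD measurableT (int_cst _) int_lin).
have devE z : ((a - theta z) ^+ 2 = ((a - b) ^+ 2 + 2 * (a - b) * (b - theta z))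
    + (b - theta z) ^+ 2)%R by ring.
rewrite (eq_integral (fun z => (((a - b) ^+ 2 + 2 * (a - b) * (b - theta z))%R
    + ((b - theta z) ^+ 2)%R)%:E)); last by move=> z _; rewrite devE.
rewrite integral_EFin_Rintegral; last first.
  exact: (integrableD measurableT int_aff int_sq).
rewrite RintegralD// RintegralD//; last exact: int_cst.
rewrite (RintegralZl _ measurableT int_dev) RintegralB//; last exact: int_cst.
rewrite !Rintegral_cst//.
have -> : fine (P setT) = 1%R by rewrite probability_setT.
by rewrite !mulr1 subrr mulr0 addr0 EFinD -integral_EFin_Rintegral.
Qed.

(** The expected loss is a squared bias plus a constant [D], and some action attains bias zero. An
    optimal [alpha] therefore satisfies [v a = b] almost surely. *)
Lemma quadratic_loss_optimal (alpha : probability A R) :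
  (forall nu : probability A R,
    \int[P \x nu]_w (- (v w.2 - theta w.1) ^+ 2)%:E <=
    \int[P \x alpha]_w (- (v w.2 - theta w.1) ^+ 2)%:E) ->
  \int[alpha]_a (v a)%:E = \int[P]_z (theta z)%:E.
Proof.
move=> opt; pose D := \int[P]_z ((b - theta z) ^+ 2)%:E.
pose loss (w : Z * A) := ((v w.2 - theta w.1) ^+ 2)%:E.
have mloss : measurable_fun setT loss.
  apply/measurable_EFinP/measurable_funX/measurable_funB.
    exact: (measurableT_comp mv).
  exact: (measurableT_comp mtheta).
have mbias : measurable_fun setT (fun a => ((v a - b) ^+ 2)%:E).
  by apply/measurable_EFinP/measurable_funX/measurable_funB.
have D0 : 0 <= D by apply: integral_ge0 => z _; rewrite lee_fin sqr_ge0.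
(* Finiteness allows [D] to be cancelled when two losses are compared. *)
have Dfin : D \is a fin_num.
  rewrite /D integral_EFin_Rintegral//.
  by apply: (@bounded_integrable _ _ _ P _ 1%R) => //; exact: measurable_funX.
have lossE (nu : probability A R) :
    \int[P \x nu]_w (- (v w.2 - theta w.1) ^+ 2)%:E =
    - (\int[nu]_a ((v a - b) ^+ 2)%:E + D).
  transitivity (- \int[P \x nu]_w ((v w.2 - theta w.1) ^+ 2)%:E).
    apply: (@integral_ge0N _ _ _ (P \x nu) setT loss) => w _.
    by rewrite lee_fin sqr_ge0.
  congr (- _).
  transitivity (\int[nu]_a \int[P]_z ((v a - theta z) ^+ 2)%:E).
    apply: (fubini_tonelli2 loss) => //.
    by move=> w; rewrite lee_fin sqr_ge0.
  rewrite (eq_integral (fun a => ((v a - b) ^+ 2)%:E + D)); last first.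
    by move=> a _; exact: bias_variance.
  rewrite ge0_integralD//; last by move=> a _; rewrite lee_fin sqr_ge0.
  by rewrite [X in _ + X]integral_cst// [X in _ * X]probability_setT mule1.
(* The comparison deviation is the Dirac mass at an action whose value is the mean [b]; its loss is
   exactly [D]. *)
have [a0 va0] := v_surj b01.
have /ae_eq_integral_abs : \int[alpha]_a `|((v a - b) ^+ 2)%:E| = 0.
  apply/eqP; rewrite eq_le integral_ge0// andbT.
  under eq_integral do rewrite gee0_abs ?lee_fin ?sqr_ge0//.
  have := opt (\d_a0); rewrite !lossE leeN2 integral_dirac//.
  by rewrite diracT mul1e va0 subrr expr0n/= add0e -leeBrDr// subee.
move=> /(_ measurableT mbias) vb.
rewrite (integral_EFin_Rintegral int_theta) -/b.
rewrite (@ae_eq_integral _ _ _ alpha setT (cst b%:E))//.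
- by rewrite integral_cst// [X in _ * X]probability_setT mule1.
- exact/measurable_EFinP.
- apply: filterS vb => a /(_ I) /= [] /eqP.
  by rewrite sqrf_eq0 subr_eq0 => /eqP ->.
Qed.

End quadratic_loss.

(** * Covariance with a variable whose conditional mean offsets [M] *)

Section covariance_cond_mean.
Context d d1 d2 (O : measurableType d) (T : measurableType d1)
  (Z : measurableType d2) (R : realType).
Variables (P : probability O R) (f : O -> T) (g : O -> Z)
  (K : R.-pker T ~> Z) (theta : Z -> R) (M : O -> R) (c : R).
Hypotheses (mf : measurable_fun [set: O] f) (mg : measurable_fun [set: O] g)
  (condK : is_cond_law P f g K)
  (mtheta : measurable_fun [set: Z] theta)
  (theta01 : forall z, (0 <= theta z <= 1)%R)
  (mM : measurable_fun [set: O] M) (M01 : forall w, (0 <= M w <= 1)%R).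

Let cmean := expected_value theta K.

Let mcmean : measurable_fun [set: O] (cmean \o f).
Proof. by apply: measurableT_comp => //; exact: measurable_expected_value. Qed.

Hypothesis Mc : {ae P, forall w, (M w + cmean (f w))%R = c}.

(* A version of [M] that is a function of [f], cut off at [0] because
   [ge0_integral_cond_law] only applies to nonnegative functions. *)
Let phi (t : T) : R := Num.max 0%R (c - cmean t)%R.

Let mphi : measurable_fun [set: T] phi.
Proof.
apply: measurable_maxr => //; apply: measurable_funB => //.
exact: measurable_expected_value.
Qed.

Let Mphi : {ae P, forall w, M w = phi (f w)}.
Proof.
apply: filterS Mc => w Mw; rewrite /phi -Mw addrK.
by apply/esym/max_idPr; case/andP: (M01 w).
Qed.

(** The characteristic property of the conditional mean, for nonnegative weights that depend on [f]
    only. *)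
Let integral_weighted (h : T -> R) : measurable_fun [set: T] h ->
  (forall t, (0 <= h t)%R) ->
  \int[P]_w (h (f w) * theta (g w))%:E = \int[P]_w (h (f w) * cmean (f w))%:E.
Proof.
move=> mh h0.
have theta0 z : 0 <= (theta z)%:E by rewrite lee_fin; case/andP: (theta01 z).
rewrite (@ge0_integral_cond_law _ _ _ _ _ _ _ P f g K mf mg
  (fun z => (h z.1 * theta z.2)%:E))//=; last first.
- by move=> z; rewrite EFinM mule_ge0// lee_fin.
- apply/measurable_EFinP/measurable_funM.
    exact: (measurableT_comp mh).
  exact: (measurableT_comp mtheta).
apply: eq_integral => w _.
under eq_integral do rewrite EFinM.
rewrite ge0_integralZl// ?lee_fin//; last exact/measurable_EFinP.
by rewrite -expected_valueE// -EFinM.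
Qed.

(** Let [e] and [q] be the first two moments of [M]. Since [M] is almost surely a function of [f],
    [theta] may be replaced by its conditional mean [c - M]: its expectation is [c - e] and that of
    the product is [c * e - q]. The covariance is then [e ^+ 2 - q]. *)
Lemma covariance_cond_mean : covariance P M (theta \o g) = - 'V_P[M].
Proof.
pose X := theta \o g.
have mX : measurable_fun setT X by exact: measurableT_comp.
have X01 w : (0 <= X w <= 1)%R by exact: theta01.
have bnd (h : O -> R) : measurable_fun setT h ->
    (forall w, (0 <= h w <= 1)%R) -> P.-integrable setT (EFin \o h).
  move=> mh h01; apply: (@bounded_integrable _ _ _ P h 1%R) => // w.
  by have /andP[w0 w1] := h01 w; rewrite ger0_norm.
have mul01 (h k : O -> R) : (forall w, (0 <= h w <= 1)%R) ->
    (forall w, (0 <= k w <= 1)%R) -> forall w, (0 <= (h * k)%R w <= 1)%R.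
  move=> h01 k01 w; have /andP[h0 h1] := h01 w; have /andP[k0 k1] := k01 w.
  by rewrite mulr_ge0//= mulr_ile1.
have intM : P.-integrable setT (EFin \o M) by exact: bnd.
have intX : P.-integrable setT (EFin \o X) by exact: bnd.
have intMX : P.-integrable setT (EFin \o (M * X)%R).
  by apply: bnd; [exact: measurable_funM|exact: mul01].
have intMM : P.-integrable setT (EFin \o (M * M)%R).
  by apply: bnd; [exact: measurable_funM|exact: mul01].
pose e := (\int[P]_w M w)%R; pose q := (\int[P]_w (M * M)%R w)%R.
have EM : 'E_P[M] = e%:E by rewrite unlock integral_EFin_Rintegral.
have EMM : 'E_P[(M * M)%R] = q%:E by rewrite unlock integral_EFin_Rintegral.
have int_cst r : P.-integrable setT (EFin \o (cst r : O -> R)).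
  exact: finite_measure_integrable_cst.
have intcM : P.-integrable setT (EFin \o (fun w => c * M w)%R).
  exact: (integrableZl measurableT c intM).
have EX : 'E_P[X] = (c - e)%:E.
  rewrite unlock.
  transitivity (\int[P]_w (cmean (f w))%:E).
    (* The constant weight gives the law of total expectation. *)
    have := @integral_weighted (cst 1%R) (measurable_cst _) (fun=> ler01).
    under eq_integral do rewrite mul1r.
    by move=> ->; under eq_integral do rewrite mul1r.
  rewrite (@ae_eq_integral _ _ _ P setT (fun w => (c - M w)%:E))//.
  - rewrite integral_EFin_Rintegral; last first.
      exact: (integrableB measurableT (int_cst c) intM).
    rewrite RintegralB//; last exact: int_cst.
    rewrite Rintegral_cst// (_ : fine (P setT) = 1%R) ?mulr1//.
    by rewrite probability_setT.
  - exact/measurable_EFinP.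
  - by apply/measurable_EFinP; exact: measurable_funB.
  - by apply: filterS Mc => w <- _; rewrite addrC addKr.
have EMX : 'E_P[(M * X)%R] = (c * e - q)%:E.
  rewrite unlock.
  (* Passing to the version [phi (f w)] of [M] makes it an admissible weight. *)
  transitivity (\int[P]_w (phi (f w) * theta (g w))%:E).
    apply: ae_eq_integral => //.
    - by apply/measurable_EFinP; exact: measurable_funM.
    - apply/measurable_EFinP/measurable_funM => //.
      exact: (measurableT_comp mphi).
    - by apply: filterS Mphi => w Mw _; rewrite -Mw.
  rewrite integral_weighted//; last by move=> t; rewrite /phi le_max lexx.
  rewrite (@ae_eq_integral _ _ _ P setT
    (fun w => (c * M w - (M * M)%R w)%:E))//.
  - rewrite integral_EFin_Rintegral; last first.
      exact: (integrableB measurableT intcM intMM).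
    by rewrite RintegralB// RintegralZl.
  - apply/measurable_EFinP/measurable_funM => //.
    exact: (measurableT_comp mphi).
  - by apply/measurable_EFinP/measurable_funB; exact: measurable_funM.
  - apply: filterS2 Mc Mphi => w Mw <- _; congr EFin.
    rewrite (_ : (M * M)%R w = M w * M w)%R//.
    by rewrite (_ : cmean (f w) = c - M w)%R; [ring|rewrite -Mw addrC addKr].
rewrite /variance !covarianceE ?Lfun1_integrable//; try exact/Lfun1_integrable.
rewrite -/X EMX EM EX EMM -!EFinM -!EFinB -EFinN; congr EFin; ring.
Qed.

End covariance_cond_mean.

(** * Trace spaces, and the two claims about equilibria *)

Section subspace.
Context d (T : measurableType d) (A : nonempty_set T).

Lemma measurable_subspace_val :
  measurable_fun [set: subspace_of A] (@subspace_val _ _ A).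
Proof. by move=> _ Y mY; exists Y. Qed.

Lemma subspace_valP (x : subspace_of A) : (A : set T) (subspace_val x).
Proof. exact: set_valP. Qed.

Lemma subspace_val_surj (y : T) :
  (A : set T) y -> exists x : subspace_of A, subspace_val x = y.
Proof. by move=> Ay; exists (exist _ y (mem_set Ay)). Qed.

End subspace.

Theorem corollary2 (R : realType) (k n : nat)
  (Theta : nonempty_set (k.-tuple R)) (SA SB : nonempty_set (n.-tuple R))
  (dXA dXB dT : measure_display) (XA : measurableType dXA)
  (XB : measurableType dXB) (T : measurableType dT)
  (prior : probability (subspace_of Theta) R)
  (F : R.-pker (subspace_of Theta) ~> (subspace_of SA * subspace_of SB)%type)
  (KA : R.-pker (subspace_of SA) ~> (subspace_of SB))
  (KB : R.-pker (subspace_of SB) ~> (subspace_of SA))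
  (m : XA * XB -> R) (tau : XA * XB -> T)
  (borel_Theta : measurable (Theta : set (k.-tuple R)))
  (borel_XA : standard_borel R XA) (borel_XB : standard_borel R XB)
  (borel_T : standard_borel R T)
  (support_SA : topological_support
     (pushforward (signal_lawA prior F) (@subspace_val _ _ SA)) = SA)
  (support_SB : topological_support
     (pushforward (signal_lawB prior F) (@subspace_val _ _ SB)) = SB)
  (abs_cont : signal_law prior F `<<
     (signal_lawA prior F \x signal_lawB prior F))
  (cond_KA : is_cond_law (signal_law prior F) fst snd KA)
  (cond_KB : is_cond_law (signal_law prior F) snd fst KB)
  (signals_A : identifiable (signal_lawA prior F) KA)
  (signals_B : identifiable (signal_lawB prior F) KB)
  (m_meas : measurable_fun [set: XA * XB] m)
  (m_itv : forall x, (0 <= m x <= 1)%R)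
  (tau_meas : measurable_fun [set: XA * XB] tau)
  (m_tau : measurable_fun [set: g_sigma_algebra_preimageType tau] m) :
  (forall (dA : measure_display) (A : measurableType dA) (v : A -> R)
     (uG : XA * XB -> A -> subspace_of Theta -> R)
     (sigmaA : R.-pker (subspace_of SA) ~> XA)
     (sigmaB : R.-pker (subspace_of SB) ~> XB) (alpha : R.-pker T ~> A),
     standard_borel R A ->
     measurable_fun [set: (XA * XB) * subspace_of Theta * A]
       (fun w => uG w.1.1 w.2 w.1.2) ->
     bayes_nash prior F sigmaA sigmaB m tau v uG alpha KA KB ->
     identifiable (signal_lawA prior F) sigmaA ->
     identifiable (signal_lawB prior F) sigmaB ->
     (forall a, v a = 0%R) ->
     exists c : R,
       {ae play_law prior F sigmaA sigmaB, forall w, m (actions w) = c}) /\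
  (forall (i : 'I_k)
     (sigmaA : R.-pker (subspace_of SA) ~> XA)
     (sigmaB : R.-pker (subspace_of SB) ~> XB)
     (alpha : R.-pker T ~> (subspace_of (unit_interval R))),
     let theta (s : subspace_of Theta) : R := tnth (subspace_val s) i in
     let v (a : subspace_of (unit_interval R)) : R := subspace_val a in
     let uG (x : XA * XB) a s : R := (- (v a - theta s) ^+ 2)%R in
     k = 1%N ->
     (forall s, 0 <= theta s <= 1)%R ->
     bayes_nash prior F sigmaA sigmaB m tau v uG alpha KA KB ->
     identifiable (signal_lawA prior F) sigmaA ->
     identifiable (signal_lawB prior F) sigmaB ->
     let P := play_law prior F sigmaA sigmaB in
     let M w := m (actions w) in
     let theta_w w := theta (state w) in
     covariance P M theta_w = - 'V_P[M] /\ - 'V_P[M] <= 0).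
Proof.
split.
  move=> dA A v uG sigmaA sigmaB alpha _ _ bn _ idB v_eq0.
  have mv : measurable_fun [set: A] v.
    by rewrite (_ : v = cst 0%R)//; apply/funext => a; rewrite v_eq0.
  have v01 a : (0 <= v a <= 1)%R by rewrite v_eq0 lexx ler01.
  have [c mc] := total_payoff_constant m_meas m_itv tau_meas mv v01 abs_cont
    cond_KA cond_KB signals_A idB bn.
  exists c; apply: filterS mc => w <-.
  (* With [v] zero the government contributes nothing, so the constant total payoff is the market
     outcome itself. *)
  rewrite /expected_value integral0_eq ?addr0// => a _.
  by rewrite v_eq0.
move=> i sigmaA sigmaB alpha theta v uG _ theta01 bn _ idB P M theta_w.
suff covE : covariance P M theta_w = - 'V_P[M].
  by split => //; rewrite leeNl oppe0 variance_ge0.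
have mv : measurable_fun setT v by exact: measurable_subspace_val.
have v01 a : (0 <= v a <= 1)%R.
  by have := subspace_valP a; rewrite /unit_interval/= in_itv.
have mtheta : measurable_fun setT theta.
  exact: (measurableT_comp (measurable_tnth i)
    (@measurable_subspace_val _ _ Theta)).
have [c mc] := total_payoff_constant m_meas m_itv tau_meas mv v01 abs_cont
  cond_KA cond_KB signals_A idB bn.
have [_ _ [K condK gov]] := bn.
have mact := @measurable_actions _ _ _ _ _ (subspace_of Theta)
  (subspace_of SA) (subspace_of SB) XA XB.
have mstate := @measurable_state _ _ _ _ _ (subspace_of Theta)
  (subspace_of SA) (subspace_of SB) XA XB.
have mf := measurableT_comp tau_meas mact.
have mg := measurable_fun_pair mact mstate.
(* The government's posterior is over actions and state jointly; [thetaZ] reads off the state. *)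
pose thetaZ (z : (XA * XB) * subspace_of Theta) : R := theta z.2.
have mthetaZ : measurable_fun setT thetaZ by exact: (measurableT_comp mtheta).
have mM : measurable_fun setT M by exact: (measurableT_comp m_meas).
(* Conditioning is on the statistic. What remains is to turn the constancy of [m] plus the expected
   action into that of [m] plus the posterior mean of the state. *)
apply: (@covariance_cond_mean _ _ _ _ _ _ _ P _ _ K thetaZ M c
  mf mg condK) => //.
- by move=> z; exact: theta01.
- by move=> w; exact: m_itv.
have [N [mN N0 govN]] := gov.
(* Optimality holds for almost every statistic; the exceptional set is pulled back to a null set of
   plays. *)
have govP : {ae P, forall w, ~ N (tau (actions w))}.
  exists ((tau \o @actions _ _ _ _ _ _ _ _ _ _) @^-1` N); split => //.
    by have := mf measurableT _ mN; rewrite setTI.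
  by move=> w /= /contrapT.
apply: filterS2 mc govP => w <- nN.
have opt := contrapT (fun h => nN (govN _ h)).
pose t := tau (actions w).
have thetaZ01 z : (0 <= thetaZ z <= 1)%R by exact: theta01.
have v_surj r : (0 <= r <= 1)%R -> exists a, v a = r.
  by move=> r01; apply: subspace_val_surj; rewrite /= in_itv.
(* At the realized statistic [t], the lemma on quadratic losses is applied to the posterior [K t]:
   the mean action equals the posterior mean. *)
have meanE := quadratic_loss_optimal (P := kernel_law K t) mthetaZ thetaZ01
  mv v_surj (alpha := kernel_law alpha t) (fun nu => (opt nu).2).
by rewrite /expected_value -[X in fine X]meanE.
Qed.
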